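(* Let $d\ge3$. The coupling creation functional $\mathcal{C}$ of the spherically coupled Nanbu particle system with angular kernel $b$, defined by $$\mathcal{C}(u,v,u_\ast,v_\ast)=-L_c\big[(u,v,u_\ast,v_\ast)\mapsto|u-v|^2+|u_\ast-v_\ast|^2\big](u,v,u_\ast,v_\ast),$$ is given, for all $(u,v,u_\ast,v_\ast)\in(\mathbb{R}^d\times\mathbb{R}^d)^2$, by $$\mathcal{C}(u,v,u_\ast,v_\ast)=\lambda\,\frac{c_{d-1}}{c_{d-3}}\Big(|u-u_\ast||v-v_\ast|-(u-u_\ast)\cdot(v-v_\ast)\Big)\ge0.$$
   Context: $b$ is a positive measure on $[0,\pi]$ with $\lambda=\int_{[0,\pi]}\sin^2\theta\,b(\mathrm{d}\theta)<+\infty$, and $c_k=\int_0^{\pi/2}\sin^k\varphi\,\mathrm{d}\varphi$. Isotropic transition: for $\theta\in[0,\pi]$, $n\in\mathbb{S}^{d-1}$, $c_\theta(n,\cdot)$ is the uniform probability on $\{n'\in\mathbb{S}^{d-1}:n\cdot n'=\cos\theta\}$. Spherical coupling: for $n_u,n_v\in\mathbb{S}^{d-1}$ with $n_u\ne-n_v$, $\mathrm{Coupl}_{n_u,n_v}$ is the rotation of $\mathbb{R}^d$ that fixes $\mathrm{Span}(n_u,n_v)^\perp$ and acts on the plane $\mathrm{Span}(n_u,n_v)$ as the rotation bringing $n_u$ to $n_v$ (the identity if $n_u=n_v$). The coupled transition $c_{c,\theta}(n_u,n_v,\mathrm{d}n'_u\mathrm{d}n'_v)$ is the law of $(n'_u,n'_v)$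 where $n'_u\sim c_\theta(n_u,\cdot)$ and $n'_v=\mathrm{Coupl}_{n_u,n_v}(n'_u)$ if $n_u\neq-n_v$; if $n_u=-n_v$, $n'_v=R_\sigma n'_u$, where $\sigma$ is uniform on $\mathbb{S}^{d-1}$, independent of $n'_u$, and $R_\sigma$ is the half-turn equal to $-\mathrm{Id}$ on $\mathrm{Span}(n_u,\sigma)$ and to $\mathrm{Id}$ on its orthogonal complement. Coupled collisions: for $(u,v,u_\ast,v_\ast)$, put $n_u=\frac{u-u_\ast}{|u-u_\ast|}$, $n_v=\frac{v-v_\ast}{|v-v_\ast|}$ (arbitrary unit vectors when undefined), and given $(n'_u,n'_v)$: $u'=\frac12(u+u_\ast)+\frac12|u-u_\ast|n'_u$, $u'_\ast=\frac12(u+u_\ast)-\frac12|u-u_\ast|n'_u$, and similarly $v',v'_\ast$ from $v,v_\ast,n'_v$. The two-body coupled generator is $$L_c\psi(u,v,u_\ast,v_\ast)=\int\big(\psi(u',v',u'_\ast,v'_\ast)-\psi(u,v,u_\ast,v_\ast)\big)\,c_{c,\theta}(n_u,n_v,\mathrm{d}n'_u\mathrm{d}n'_v)\,b(\mathrm{d}\theta),$$ the integration being performed first over $(n'_u,n'_v)$, then over $\theta$. The coupled Nanbu particle system is the $N$-particle system on $(\mathbb{R}^d\times\mathbb{R}^d)^N$ with generator $\frac1N\sum_{n,m=1}^NL_c^{(n,m)}$ ($L_c$ acting on the particles $n$ and $m$). *)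

(* Defs.v *)
From HB Require Import structures.
From mathcomp Require Import all_boot all_order all_algebra.
From mathcomp Require Import all_classical all_reals all_analysis.
From mathcomp Require Import ring lra.

Set Implicit Arguments.
Unset Strict Implicit.
Unset Printing Implicit Defensive.

Import Order.TTheory GRing.Theory Num.Theory.
Import numFieldNormedType.Exports.

Local Open Scope classical_set_scope.
Local Open Scope ring_scope.

(* R^d is 'rV[R]_d; linear maps act on row vectors by x |-> x *m Q. *)

Section borel_rV.
Context {R : realType} {d : nat}.

Let coord (i : 'I_d) (x : 'rV[R]_d) : measurableTypeR R := x 0 i.

Let rV_set0 : g_sigma_preimage coord set0.
Proof. exact: sigma_algebra0. Qed.

Let rV_setC A : g_sigma_preimage coord A -> g_sigma_preimage coord (~` A).
Proof. by move=> mA; rewrite -setTD; exact: sigma_algebraCD. Qed.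

Let rV_bigcup (F : (set 'rV[R]_d)^nat) :
  (forall i, g_sigma_preimage coord (F i)) ->
  g_sigma_preimage coord (\bigcup_i F i).
Proof. exact: sigma_algebra_bigcup. Qed.

(* The Borel sigma-algebra of R^d, generated by the coordinate maps (the same
   convention as the library's sigma-algebra on n.-tuple T). *)
HB.instance Definition _ :=
  @isMeasurable.Build (sigma_display (g_sigma_preimage coord)) 'rV[R]_d
    (g_sigma_preimage coord) rV_set0 rV_setC rV_bigcup.

End borel_rV.

Section euclidean.
Context {R : realType} {d : nat}.
Implicit Types (n nu nv sigma x y : 'rV[R]_d) (Q : 'M[R]_d).

Definition dot x y : R := \sum_(i < d) x 0 i * y 0 i.

(* The library's `|x| on 'rV[R]_d is the sup norm. *)
Definition enorm x : R := Num.sqrt (dot x x).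

Definition sphere : set 'rV[R]_d := [set x | enorm x = 1].

Definition latitude (theta : R) n : set 'rV[R]_d :=
  [set n' | sphere n' /\ dot n n' = cos theta].

Definition orthogonal_mx Q : Prop := Q *m Q^T = 1%:M.

Definition rotation_mx Q : Prop := orthogonal_mx Q /\ \det Q = 1.

(* The uniform probability on A: the Borel probability carried by A that is
   invariant under every linear isometry of R^d mapping A onto itself. It exists
   and is unique when these isometries act transitively on A and A is compact
   and nonempty, in particular when d >= 2 for the sphere and for latitude theta n
   with n a unit vector. *)
Definition is_uniform (A : set 'rV[R]_d) (mu : probability 'rV[R]_d R) : Prop :=
  mu A = 1%E /\
  forall Q, orthogonal_mx Q -> [set x *m Q | x in A] = A ->
  forall B, measurable B -> mu ((fun x => x *m Q) @^-1` B) = mu B.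

(* The rotation fixing Span(nu, nv)^\perp and mapping nu to nv. Such a Q
   preserves Span(nu, nv), and acts there as a plane rotation since det Q = 1. *)
Definition is_coupling nu nv Q : Prop :=
  [/\ rotation_mx Q,
      forall x, dot x nu = 0 -> dot x nv = 0 -> x *m Q = x
    & nu *m Q = nv].

(* Meaningful for unit vectors nu <> - nv: see coupling_unique and couplingP. *)
Definition coupling nu nv : 'M[R]_d := xget 1%:M (is_coupling nu nv).

Definition is_half_turn nu sigma Q : Prop :=
  (forall x, (x <= nu + sigma)%MS -> x *m Q = - x) /\
  (forall x, dot x nu = 0 -> dot x sigma = 0 -> x *m Q = x).

(* Always meaningful: see half_turn_unique and half_turnP. *)
Definition half_turn nu sigma : 'M[R]_d := xget 1%:M (is_half_turn nu sigma).

End euclidean.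

Section euclidean_facts.
Context {R : realType} {d : nat}.
Implicit Types (n nu nv sigma x y z w : 'rV[R]_d) (P Q : 'M[R]_d).

Lemma dotC x y : dot x y = dot y x.
Proof. by apply: eq_bigr => i _; rewrite mulrC. Qed.

Lemma dotDl x y z : dot (x + y) z = dot x z + dot y z.
Proof. by rewrite -big_split; apply: eq_bigr => i _; rewrite mxE mulrDl. Qed.

Lemma dotZl a x y : dot (a *: x) y = a * dot x y.
Proof. by rewrite mulr_sumr; apply: eq_bigr => i _; rewrite mxE mulrA. Qed.

Lemma dotNl x y : dot (- x) y = - dot x y.
Proof. by rewrite -scaleN1r dotZl mulN1r. Qed.

Lemma dotDr x y z : dot x (y + z) = dot x y + dot x z.
Proof. by rewrite dotC dotDl !(dotC x). Qed.

Lemma dotZr a x y : dot x (a *: y) = a * dot x y.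
Proof. by rewrite dotC dotZl dotC. Qed.

Lemma dotNr x y : dot x (- y) = - dot x y.
Proof. by rewrite dotC dotNl dotC. Qed.

Lemma dot0l x : dot 0 x = 0.
Proof. by rewrite /dot big1// => i _; rewrite mxE mul0r. Qed.

Lemma dotxx_ge0 x : 0 <= dot x x.
Proof. by apply: sumr_ge0 => i _; rewrite -expr2 sqr_ge0. Qed.

Lemma dotxx_eq0 x : dot x x = 0 -> x = 0.
Proof.
move=> /eqP; rewrite psumr_eq0; last by move=> i _; rewrite -expr2 sqr_ge0.
move=> /allP x0; apply/rowP => i; rewrite mxE; apply/eqP.
by have := x0 i (mem_index_enum _); rewrite mulf_eq0 orbb.
Qed.

Lemma sphere_dot x : sphere x -> dot x x = 1.
Proof.
by rewrite /sphere /= /enorm => x1; rewrite -(sqr_sqrtr (dotxx_ge0 x)) x1 expr1n.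
Qed.

Lemma mulmx_dot x y : x *m y^T = (dot x y)%:M.
Proof.
by apply/matrixP => i j; rewrite !ord1 !mxE /=; apply: eq_bigr => k _; rewrite mxE.
Qed.

Lemma dot_orthogonal x y Q :
  orthogonal_mx Q -> dot (x *m Q) (y *m Q) = dot x y.
Proof.
move=> oQ; have /matrixP/(_ 0 0) : (x *m Q) *m (y *m Q)^T = x *m y^T.
  by rewrite trmx_mul mulmxA -(mulmxA x) oQ mulmx1.
by rewrite !mulmx_dot !mxE.
Qed.

Lemma mx_ext P Q : (forall x, x *m P = x *m Q) -> P = Q.
Proof. by move=> PQ; apply/row_matrixP => i; rewrite !rowE. Qed.

Lemma mx_ext2 a b P Q : a *m P = a *m Q -> b *m P = b *m Q ->
  (forall x, dot x a = 0 -> dot x b = 0 -> x *m P = x *m Q) -> P = Q.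
Proof.
move=> Pa Pb Pab; apply: mx_ext => x.
have divK y z : dot z y / dot y y * dot y y = dot z y.
  have [/dotxx_eq0 ->|y0] := eqVneq (dot y y) 0; last by rewrite divfK.
  by rewrite dotC !dot0l mulr0.
have [e be [ea Pe]] : exists2 e, b = e + (dot b a / dot a a) *: a &
    dot e a = 0 /\ e *m P = e *m Q.
  exists (b - (dot b a / dot a a) *: a); first by rewrite subrK.
  by rewrite dotDl dotNl dotZl divK subrr !mulmxBl -!scalemxAl Pa Pb.
have ae : dot a e = 0 by rewrite dotC.
pose y := x - (dot x a / dot a a) *: a - (dot x e / dot e e) *: e.
have ya : dot y a = 0.
  by rewrite /y !dotDl !dotNl !dotZl divK ea mulr0 subr0 subrr.
have ye : dot y e = 0.
  by rewrite /y !dotDl !dotNl !dotZl divK ae mulr0 subr0 subrr.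
have yb : dot y b = 0 by rewrite be dotDr dotZr ya ye mulr0 addr0.
have xE : x = y + (dot x e / dot e e) *: e + (dot x a / dot a a) *: a.
  by rewrite /y !subrK.
clearbody y; rewrite xE.
by rewrite !mulmxDl -!scalemxAl Pa Pe (Pab _ ya yb).
Qed.

Definition reflection w : 'M[R]_d :=
  1%:M - (2 / dot w w) *: (w^T *m w).

Lemma mul_reflection x w :
  x *m reflection w = x - (2 * dot x w / dot w w) *: w.
Proof.
rewrite mulmxBr mulmx1 -scalemxAr mulmxA mulmx_dot mul_scalar_mx scalerA.
by congr (_ - _ *: _); ring.
Qed.

Lemma reflection_orthogonal w : orthogonal_mx (reflection w).
Proof.
have rT : (reflection w)^T = reflection w.
  by rewrite /reflection linearB linearZ /= trmx1 trmx_mul trmxK.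
rewrite /orthogonal_mx rT; apply: mx_ext => x; rewrite mulmxA mulmx1.
rewrite !mul_reflection dotDl dotNl dotZl -addrA -opprD -scalerDl.
have [/dotxx_eq0 ->|w0] := eqVneq (dot w w) 0; first by rewrite scaler0 subr0.
rewrite (_ : 2 * dot x w / dot w w + _ = 0) ?scale0r ?subr0//.
by field.
Qed.

Lemma det_rank1 (u : 'cV[R]_d) (v : 'rV[R]_d) :
  \det (1%:M + u *m v) = 1 + (v *m u) 0 0.
Proof.
pose M := block_mx (1%:M : 'M[R]_1) (- v) u 1%:M.
pose U := block_mx (1%:M : 'M[R]_1) v 0 (1%:M : 'M[R]_d).
have dU : \det U = 1 by rewrite det_ublock !det1 mulr1.
have MU : \det (M *m U) = \det (1%:M + u *m v).
  rewrite mulmx_block !mul1mx !mulmx1 !mulmx0 !addr0 subrr.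
  by rewrite det_lblock det1 mul1r addrC.
have UM : \det (U *m M) = 1 + (v *m u) 0 0.
  rewrite mulmx_block !mul1mx !mulmx1 !mul0mx !add0r addNr.
  by rewrite det_lblock det1 mulr1 det_mx11 !mxE.
by rewrite -MU -UM !det_mulmx mulrC.
Qed.

Lemma det_reflection w : w != 0 -> \det (reflection w) = -1.
Proof.
move=> w0; have ww : dot w w != 0.
  by apply: contra_neq w0; exact: dotxx_eq0.
rewrite /reflection -scaleNr -mul_scalar_mx mulmxA.
rewrite -[X in _ + X]/(_ *m w) det_rank1 mul_scalar_mx -scalemxAr mulmx_dot !mxE.
by rewrite /= mulr1n; field.
Qed.

Lemma reflection_fix x w : dot x w = 0 -> x *m reflection w = x.
Proof. by move=> xw; rewrite mul_reflection xw mulr0 mul0r scale0r subr0. Qed.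

Lemma coupling_exists nu nv : sphere nu -> sphere nv -> nu <> - nv ->
  exists Q, is_coupling nu nv Q.
Proof.
move=> /sphere_dot nu1 /sphere_dot nv1 nuv.
have nu0 : nu != 0.
  by apply/eqP => nu0; move: nu1; rewrite nu0 dot0l => /esym/eqP; rewrite oner_eq0.
have w0 : nu + nv != 0 by rewrite addr_eq0; exact/eqP.
exists (reflection nu *m reflection (nu + nv)); split.
- split; last by rewrite det_mulmx !det_reflection// mulrNN mulr1.
  rewrite /orthogonal_mx trmx_mul mulmxA -(mulmxA (reflection nu)).
  by rewrite reflection_orthogonal mulmx1 reflection_orthogonal.
- move=> x xu xv; rewrite mulmxA reflection_fix// reflection_fix//.
  by rewrite dotDr xu xv addr0.
- have ww : dot (nu + nv) (nu + nv) != 0.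
    by apply: contra_neq w0; exact: dotxx_eq0.
  rewrite mulmxA (mul_reflection nu nu) nu1 mulr1 divr1 scaler_nat mulr2n opprD addNKr.
  rewrite mul_reflection dotNl.
  rewrite (_ : 2 * _ / _ = -1); first by rewrite scaleN1r opprK addKr.
  move: ww; rewrite !dotDl !dotDr nu1 nv1 (dotC nv) => ww.
  by field.
Qed.

Lemma coupling_unique nu nv P Q : sphere nu -> sphere nv -> nu <> - nv ->
  is_coupling nu nv P -> is_coupling nu nv Q -> P = Q.
Proof.
move=> /sphere_dot nu1 /sphere_dot nv1 nuv.
move=> [[oP dP] Pfix Pnu] [[oQ dQ] Qfix Qnu].
have QTQ : Q^T *m Q = 1%:M by exact: mulmx1C.
have QK x y : x *m Q = y -> y *m Q^T = x by move=> <-; rewrite -mulmxA oQ mulmx1.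
pose S := P *m Q^T.
suff S1 : S = 1%:M by rewrite -(mulmx1 P) -QTQ mulmxA -/S S1 mul1mx.
have oS : orthogonal_mx S.
  by rewrite /orthogonal_mx trmx_mul trmxK mulmxA -(mulmxA P) QTQ mulmx1.
have dS : \det S = 1 by rewrite det_mulmx det_tr dP dQ mulr1.
have Snu : nu *m S = nu by rewrite mulmxA Pnu; exact: QK.
have Sfix x : dot x nu = 0 -> dot x nv = 0 -> x *m S = x.
  by move=> xu xv; rewrite mulmxA Pfix//; apply: QK; exact: Qfix.
clearbody S; clear P Q oP dP Pfix Pnu oQ dQ Qfix Qnu QTQ QK.
have [e nve eu] : exists2 e, nv = e + dot nu nv *: nu & dot e nu = 0.
  exists (nv - dot nu nv *: nu); first by rewrite subrK.
  by rewrite dotDl dotNl dotZl nu1 mulr1 (dotC nv) subrr.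
have Sfix' x : dot x nu = 0 -> dot x e = 0 -> x *m S = x.
  by move=> xu xe; apply: Sfix => //; rewrite nve dotDr dotZr xu xe mulr0 addr0.
suff eS : e *m S = e.
  by apply: (@mx_ext2 nu e); rewrite ?mulmx1// => x xu xe; rewrite mulmx1 Sfix'.
have [e0|e0] := eqVneq (dot e e) 0; first by rewrite (dotxx_eq0 e0) mul0mx.
have eSnu : dot (e *m S) nu = 0 by rewrite -{1}Snu dot_orthogonal.
pose t := dot (e *m S) e / dot e e.
have eSt : e *m S = t *: e.
  apply/eqP; rewrite -subr_eq0; apply/eqP/dotxx_eq0.
  set z := _ - _.
  have ze : dot z e = 0 by rewrite /z dotDl dotNl dotZl /t divfK// subrr.
  have zu : dot z nu = 0 by rewrite /z dotDl dotNl dotZl eSnu eu mulr0 subrr.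
  rewrite {2}/z dotDr dotNr dotZr ze mulr0 subr0.
  by rewrite -{1}(Sfix' _ zu ze) dot_orthogonal.
have : t ^+ 2 = 1.
  apply: (mulIf e0); rewrite mul1r -[RHS](dot_orthogonal _ _ oS) eSt dotZl dotZr.
  by rewrite mulrA.
move=> /eqP; rewrite sqrf_eq1 => /orP[] /eqP t1; first by rewrite eSt t1 scale1r.
have e0' : e != 0 by apply: contra_neq e0 => ->; rewrite dot0l.
suff Sr : S = reflection e.
  by move: dS; rewrite Sr det_reflection// => m11; exfalso; lra.
apply: (@mx_ext2 nu e).
- by rewrite Snu reflection_fix// dotC.
- by rewrite eSt t1 mul_reflection mulfK// scaler_nat mulr2n opprD addNKr scaleN1r.
- by move=> x xu xe; rewrite Sfix'// reflection_fix.
Qed.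

Lemma couplingP nu nv : sphere nu -> sphere nv -> nu <> - nv ->
  is_coupling nu nv (coupling nu nv).
Proof.
by move=> u1 v1 uv; exact: (xgetPex 1%:M (coupling_exists u1 v1 uv)).
Qed.

Lemma half_turn_unique nu sigma P Q :
  is_half_turn nu sigma P -> is_half_turn nu sigma Q -> P = Q.
Proof.
move=> [PN Pfix] [QN Qfix].
by apply: (@mx_ext2 nu sigma); rewrite ?PN ?QN ?addsmxSl ?addsmxSr// => x xu xs;
  rewrite Pfix// Qfix.
Qed.

Lemma half_turnP nu sigma : is_half_turn nu sigma (half_turn nu sigma).
Proof.
suff ex : exists Q, is_half_turn nu sigma Q by exact: (xgetPex 1%:M ex).
have rN w : w *m reflection w = - w.
  rewrite mul_reflection; have [/dotxx_eq0 ->|w0] := eqVneq (dot w w) 0.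
    by rewrite scaler0 subrr oppr0.
  by rewrite mulfK// scaler_nat mulr2n opprD addNKr.
have [e se eu] : exists2 e,
    sigma = e + (dot sigma nu / dot nu nu) *: nu & dot e nu = 0.
  exists (sigma - (dot sigma nu / dot nu nu) *: nu); first by rewrite subrK.
  rewrite dotDl dotNl dotZl; have [/dotxx_eq0 ->|nu0] := eqVneq (dot nu nu) 0.
    by rewrite !(dotC _ 0) !dot0l mulr0 subrr.
  by rewrite divfK// subrr.
exists (reflection nu *m reflection e).
have nuN : nu *m (reflection nu *m reflection e) = - nu.
  by rewrite mulmxA rN mulNmx reflection_fix// dotC.
have eN : e *m (reflection nu *m reflection e) = - e.
  by rewrite mulmxA (reflection_fix eu) rN.
have sN : sigma *m (reflection nu *m reflection e) = - sigma.
  move: (_ / _) se => k ->.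
  by rewrite mulmxDl eN -scalemxAl nuN scalerN -opprD.
split.
- move=> x /sub_addsmxP[[u v] /= ->].
  by rewrite mulmxDl -(mulmxA u) -(mulmxA v) nuN sN !mulmxN -opprD.
- move=> x xu xs; rewrite mulmxA reflection_fix// reflection_fix//.
  have -> : e = sigma - (dot sigma nu / dot nu nu) *: nu by rewrite {1}se addrK.
  by rewrite dotDr dotNr dotZr xu xs mulr0 subrr.
Qed.

End euclidean_facts.

Section collisions.
Context {R : realType} {d : nat}.
Local Notation E := 'rV[R]_d.
Implicit Types (n nu nv u v us vs : E) (theta : R).

(* The direction of w, with an arbitrary unit vector e used when w = 0. *)
Definition direction e w : E := if w == 0 then e else (enorm w)^-1 *: w.

Definition collide u us n : E :=
  2^-1 *: (u + us) + (2^-1 * enorm (u - us)) *: n.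

Definition collide_star u us n : E :=
  2^-1 *: (u + us) - (2^-1 * enorm (u - us)) *: n.

(* The law of (n'_u, n'_v), for c the isotropic transition and tau the law of
   sigma; the product measure encodes the independence of sigma and n'_u. *)
Definition coupled_transition (c : R -> E -> probability E R)
    (tau : probability E R) theta nu nv : set (E * E) -> \bar R :=
  if nu == - nv
  then pushforward (c theta nu \x tau)%E (fun p => (p.1, p.1 *m half_turn nu p.2))
  else pushforward (c theta nu) (fun n => (n, n *m coupling nu nv)).

(* The values are in \bar R: the theta-integral of a function whose positive and
   negative parts both have infinite integral is -oo, never a finite number. *)
Definition coupled_generator (b : {measure set (measurableTypeR R) -> \bar R})
    (c : R -> E -> probability E R) (tau : probability E R) (eu ev : E)
    (psi : E -> E -> E -> E -> R) u v us vs : \bar R :=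
  let nu := direction eu (u - us) in
  let nv := direction ev (v - vs) in
  (\int[b]_(theta in `[0%R, pi])
    \int[coupled_transition c tau theta nu nv]_p
      (psi (collide u us p.1) (collide v vs p.2)
           (collide_star u us p.1) (collide_star v vs p.2)
       - psi u v us vs)%:E)%E.

Definition coupling_creation (b : {measure set (measurableTypeR R) -> \bar R})
    (c : R -> E -> probability E R) (tau : probability E R) (eu ev : E)
    u v us vs : \bar R :=
  (- coupled_generator b c tau eu ev
       (fun u v us vs => enorm (u - v) ^+ 2 + enorm (us - vs) ^+ 2)%R u v us vs)%E.

End collisions.

Section kernel_constants.
Context {R : realType}.

(* The angular kernel on [0, pi] is the restriction of b to [0, pi]. *)
Definition lambda (b : {measure set (measurableTypeR R) -> \bar R}) : \bar R :=
  (\int[b]_(theta in `[0%R, pi]) (sin theta ^+ 2)%:E)%E.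

Definition sin_integral (k : nat) : R :=
  \int[lebesgue_measure]_(phi in `[0, pi / 2]) (sin phi ^+ k).

End kernel_constants.

(* Main.v *)
Require Import Defs.
From HB Require Import structures.
From mathcomp Require Import all_boot all_order all_algebra.
From mathcomp Require Import all_classical all_reals all_analysis.
From mathcomp Require Import measurable_realfun ring lra.

Set Implicit Arguments.
Unset Strict Implicit.
Unset Printing Implicit Defensive.

Import Order.TTheory GRing.Theory Num.Theory.
Import numFieldNormedType.Exports.

Local Open Scope classical_set_scope.
Local Open Scope ring_scope.

(** Write r = |u - us|, s = |v - vs|, k = nu . nv. A collision preserves the
    half-sum of the two velocities of each of the two systems and only turns
    their differences r nu and s nv into r n'_u and s n'_v, so the cost
    |u - v|^2 + |us - vs|^2 changes by exactly r s (k - n'_u . n'_v)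
    ([cost_increment]). The theorem is thus the computation of the mean of
    n'_u . n'_v.

    For a fixed matrix A, the mean of x . (x A) under the isotropic law at
    colatitude theta around nu is linear in the matrix of second moments of that
    law. This matrix commutes with every reflection in a hyperplane containing
    nu, because these reflections preserve the law; hence it is of the form
    beta Id + (alpha - beta) nu^T nu ([commutant_reflections]), where
    alpha = cos^2 theta is the mean of (x . nu)^2, and
    alpha + (d - 1) beta = 1 because the trace is the mean of |x|^2. So the
    mean of x . (x A) depends on A only through tr A and nu . (nu A)
    ([isotropic_average]).

    Both couplings are products of two reflections, which gives their traces.
    When nu <> - nv, the trace is d - 2 + 2 k and nu . (nu A) = k. When
    nu = - nv, the half-turn has nu . (nu A) = - 1, and its trace is d - 4 unless
    sigma is on the axis of nu, which has probability 0; Fubini lets one integrate in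
    n'_u first. In both cases the mean of n'_u . n'_v is
    cos^2 theta k + sin^2 theta (d - 2 + k) / (d - 1), that is,
    k + sin^2 theta (1 - k) (d - 2) / (d - 1).
    Finally (d - 2) / (d - 1) = c_(d-1) / c_(d-3) is the Wallis recursion, and
    r s (1 - k) is |u - us| |v - vs| - (u - us) . (v - vs), also when
    r = 0 or s = 0. *)

(** * Euclidean geometry: reflections and their products *)

Section euclidean_complements.
Context {R : realType} {d : nat}.
Implicit Types (n nu nv sigma w x y f : 'rV[R]_d) (A B M Q : 'M[R]_d).

Lemma dotBl x y w : dot (x - y) w = dot x w - dot y w.
Proof. by rewrite dotDl dotNl. Qed.

Lemma dotBr x y w : dot w (x - y) = dot w x - dot w y.
Proof. by rewrite dotDr dotNr. Qed.

Lemma enorm_sqr x : enorm x ^+ 2 = dot x x.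
Proof. by rewrite sqr_sqrtr// dotxx_ge0. Qed.

Lemma sphereE x : dot x x = 1 -> sphere x.
Proof. by move=> x1; rewrite /sphere /= /enorm x1 sqrtr1. Qed.

Lemma dot_unit_le1 x y : sphere x -> sphere y -> `|dot x y| <= 1.
Proof.
move=> /sphere_dot x1 /sphere_dot y1; rewrite ler_norml.
have := dotxx_ge0 (x + y); have := dotxx_ge0 (x - y).
by rewrite !(dotBl, dotBr, dotDl, dotDr) x1 y1 (dotC y x) => h1 h2; lra.
Qed.

Lemma direction_sphere e w : sphere e -> sphere (direction e w).
Proof.
move=> e1; rewrite /direction; case: eqVneq => // w0; apply: sphereE.
have ww : dot w w != 0 by apply: contra_neq w0; exact: dotxx_eq0.
have ew : enorm w != 0 by rewrite -sqrf_eq0 enorm_sqr.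
by rewrite dotZl dotZr -enorm_sqr; field.
Qed.

(** True for w = 0 as well, so that no case distinction on vanishing relative
    velocities is needed later. *)
Lemma enorm_direction e w : enorm w *: direction e w = w.
Proof.
rewrite /direction; case: eqVneq => [->|w0].
  by rewrite /enorm dot0l sqrtr0 scale0r.
have ww : dot w w != 0 by apply: contra_neq w0; exact: dotxx_eq0.
have ew : enorm w != 0 by rewrite -sqrf_eq0 enorm_sqr.
by rewrite scalerA divff// scale1r.
Qed.

Lemma mul_reflection_self w : w *m reflection w = - w.
Proof.
rewrite mul_reflection; have [/dotxx_eq0 ->|w0] := eqVneq (dot w w) 0.
  by rewrite scaler0 subrr oppr0.
by rewrite mulfK// scaler_nat mulr2n opprD addNKr.
Qed.

Lemma orthogonal_mxM A B :
  orthogonal_mx A -> orthogonal_mx B -> orthogonal_mx (A *m B).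
Proof.
move=> oA oB; rewrite /orthogonal_mx trmx_mul mulmxA -(mulmxA A).
by rewrite oB mulmx1.
Qed.

Lemma orthogonal_mxT A : orthogonal_mx A -> A^T *m A = 1%:M.
Proof. by move=> /mulmx1C. Qed.

Lemma orthogonal_sphere Q x : orthogonal_mx Q -> sphere x -> sphere (x *m Q).
Proof. by move=> oQ /sphere_dot x1; apply: sphereE; rewrite dot_orthogonal. Qed.

Lemma trmx_reflection w : (reflection w)^T = reflection w.
Proof. by rewrite /reflection linearB linearZ /= trmx1 trmx_mul trmxK. Qed.

Lemma reflectionK w : reflection w *m reflection w = 1%:M.
Proof. by rewrite -{2}(trmx_reflection w) reflection_orthogonal. Qed.

Lemma mxtrace_outer x y : \tr (x^T *m y) = dot y x.
Proof. by rewrite mxtrace_mulC mulmx_dot mxtrace_scalar mulr1n. Qed.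

Lemma dot_mulmx x A y : dot (x *m A) y = dot x (y *m A^T).
Proof.
have : (x *m A) *m y^T = x *m (y *m A^T)^T by rewrite trmx_mul trmxK mulmxA.
by move=> /matrixP/(_ 0 0); rewrite !mulmx_dot !mxE.
Qed.

Lemma reflection_swap x y : dot x x = dot y y ->
  x *m reflection (x - y) = y.
Proof.
move=> xy; have [/dotxx_eq0 /eqP|w0] := eqVneq (dot (x - y) (x - y)) 0.
  rewrite subr_eq0 => /eqP->; rewrite subrr mul_reflection scaler0 subr0//.
rewrite mul_reflection (_ : 2 * _ / _ = 1) ?scale1r ?subKr//.
move: w0; rewrite !(dotBl, dotBr) xy (dotC y x) => w0.
by field.
Qed.

(** If every vector orthogonal to nu were 0, the identity would be the rank-one
    matrix nu^T nu, whose trace is 1 and not d. *)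
Lemma exists_unit_orthogonal nu : (1 < d)%N -> sphere nu ->
  exists f, sphere f /\ dot f nu = 0.
Proof.
move=> d1 /sphere_dot nu1.
have [[w [wu /eqP w0]]|] := pselect (exists w, dot w nu = 0 /\ w <> 0).
  exists (direction nu w); split; first exact/direction_sphere/sphereE.
  by rewrite /direction (negbTE w0) dotZl wu mulr0.
move=> /forallNP h.
have e1 : 1%:M = nu^T *m nu.
  apply: mx_ext => x; rewrite mulmx1 mulmxA mulmx_dot mul_scalar_mx.
  apply/eqP; rewrite -subr_eq0; apply/eqP; apply: contrapT => z0.
  apply: (h (x - dot x nu *: nu)); split => //.
  by rewrite dotBl dotZl nu1 mulr1 subrr.
have := congr1 mxtrace e1; rewrite mxtrace1 mxtrace_outer nu1 => /eqP.
by rewrite (eqr_nat R d 1) => /eqP d1'; rewrite d1' in d1.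
Qed.

(** Commuting with the reflection along w amounts to
    (x . w) (w M) = (x M . w) w for all x: each w orthogonal to nu is an
    eigenvector, with an eigenvalue independent of w, and the line of nu is
    stable. *)
Lemma commutant_reflections nu M : (1 < d)%N -> sphere nu ->
  (forall w, dot w nu = 0 -> reflection w *m M = M *m reflection w) ->
  exists alpha beta, M = beta *: 1%:M + (alpha - beta) *: (nu^T *m nu).
Proof.
move=> d1 su comm; have nu1 := sphere_dot su.
have {comm}key w x : dot w nu = 0 ->
    dot x w *: (w *m M) = dot (x *m M) w *: w.
  move=> wu; have [/dotxx_eq0 ->|w0] := eqVneq (dot w w) 0.
    by rewrite mul0mx !scaler0.
  have /(congr1 (fun A => x *m A)) := comm w wu.
  rewrite !mulmxA !mul_reflection mulmxBl -scalemxAl => /addrI/oppr_inj.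
  have c0 : 2 / dot w w != 0 by rewrite mulf_neq0 ?invr_eq0.
  by move=> h; apply: (scalerI c0); rewrite !scalerA !(mulrAC _ (dot w w)^-1).
have [f [sf fu]] := exists_unit_orthogonal d1 su.
pose beta := dot (f *m M) f.
have fM : f *m M = beta *: f by rewrite -key// (sphere_dot sf) scale1r.
have orthM w : dot w nu = 0 -> w *m M = beta *: w.
  move=> wu.
  have gen y : dot y nu = 0 -> dot f y != 0 -> y *m M = beta *: y.
    move=> yu fy; apply: (scalerI fy).
    by rewrite key// fM dotZl !scalerA mulrC.
  (* A vector orthogonal to f is the difference of w + f and f, to which gen
     and fM apply. *)
  have [fw|] := eqVneq (dot f w) 0; last exact: gen.
  have := gen (w + f); rewrite dotDl wu fu addr0 dotDr fw add0r.
  rewrite (sphere_dot sf) oner_eq0 => /(_ erefl isT).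
  by rewrite mulmxDl fM scalerDr => /addIr.
pose alpha := dot (nu *m M) nu.
have nuM : nu *m M = alpha *: nu.
  pose z := nu *m M - alpha *: nu.
  have zu : dot z nu = 0 by rewrite /z dotBl dotZl nu1 mulr1 subrr.
  have /eqP : z = 0.
    have [//|z0] := eqVneq (dot z z) 0; first exact: dotxx_eq0.
    have := key z nu zu; rewrite dotC zu scale0r => /esym/eqP.
    rewrite scaler_eq0 => /orP[/eqP nz|/eqP//].
    by apply: dotxx_eq0; rewrite {1}/z dotBl dotZl nz dotC zu mulr0 subrr.
  by rewrite subr_eq0 => /eqP.
exists alpha, beta; apply: mx_ext => x.
pose w := x - dot x nu *: nu.
have wu : dot w nu = 0 by rewrite /w dotBl dotZl nu1 mulr1 subrr.
have -> : x = w + dot x nu *: nu by rewrite subrK.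
move: (dot x nu) => k; clearbody w.
rewrite mulmxDl -scalemxAl nuM orthM// mulmxDr -!scalemxAr mulmx1.
rewrite mulmxA mulmx_dot dotDl dotZl wu nu1 add0r mulr1 mul_scalar_mx.
rewrite scalerDr -addrA; congr (_ + _).
by rewrite !scalerA -scalerDl; congr (_ *: _); ring.
Qed.

Lemma trace_mul_reflections w z :
  dot w w != 0 -> dot z z != 0 ->
  \tr (reflection w *m reflection z)
  = d%:R - 4 + 4 * dot w z ^+ 2 / (dot w w * dot z z).
Proof.
move=> w0 z0.
rewrite /reflection mulmxBl mul1mx mulmxBr mulmx1 -!scalemxAl -scalemxAr.
rewrite -mulmxA (mulmxA w) mulmx_dot mul_scalar_mx -scalemxAr.
rewrite !raddfB /= !linearZ /= !mxtrace_outer mxtrace1 (dotC z w).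
by rewrite /GRing.scale /=; field; rewrite w0 z0.
Qed.

(** The product has determinant 1 and fixes what is orthogonal to nu and nv; the
    first reflection sends nu to - nu, which the second sends to nv. *)
Lemma coupling_reflections nu nv : sphere nu -> sphere nv -> nu <> - nv ->
  coupling nu nv = reflection nu *m reflection (nu + nv).
Proof.
move=> su sv nuv; apply: (coupling_unique su sv nuv); first exact: couplingP.
have nu1 := sphere_dot su; have nv1 := sphere_dot sv.
have nu0 : nu != 0.
  by apply/eqP => nu0; move: nu1; rewrite nu0 dot0l => /esym/eqP; rewrite oner_eq0.
have w0 : nu + nv != 0 by rewrite addr_eq0; exact/eqP.
split.
- split; first by apply: orthogonal_mxM; exact: reflection_orthogonal.
  by rewrite det_mulmx !det_reflection// mulrNN mulr1.
- move=> x xu xv; rewrite mulmxA !reflection_fix//.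
  by rewrite dotDr xu xv addr0.
- rewrite mulmxA mul_reflection_self -{2}(opprK nv) mulNmx.
  have -> : nu + nv = nu - - nv by rewrite opprK.
  by rewrite reflection_swap ?opprK// dotNl dotNr opprK nu1 nv1.
Qed.

Lemma coupling_orthogonal nu nv : sphere nu -> sphere nv -> nu <> - nv ->
  orthogonal_mx (coupling nu nv).
Proof. by move=> su sv nuv; have [[]] := couplingP su sv nuv. Qed.

Lemma coupling_trace nu nv : sphere nu -> sphere nv -> nu <> - nv ->
  \tr (coupling nu nv) = d%:R - 2 + 2 * dot nu nv.
Proof.
move=> su sv nuv; rewrite coupling_reflections//.
have nu1 := sphere_dot su; have nv1 := sphere_dot sv.
have w0 : dot (nu + nv) (nu + nv) != 0.
  by apply/eqP => /dotxx_eq0/eqP; rewrite addr_eq0 => /eqP.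
rewrite trace_mul_reflections ?nu1 ?oner_eq0//.
move: w0; rewrite !(dotDl, dotDr) nu1 nv1 (dotC nv nu) => w0.
by field.
Qed.

Definition orth_part nu sigma : 'rV[R]_d := sigma - dot sigma nu *: nu.

Lemma dot_orth_part nu sigma : sphere nu -> dot (orth_part nu sigma) nu = 0.
Proof. by move=> /sphere_dot nu1; rewrite dotBl dotZl nu1 mulr1 subrr. Qed.

(** nu and the component of sigma orthogonal to nu form an orthogonal basis of
    Span(nu, sigma), so that the half-turn is the product of the reflections along
    them. If sigma is on the axis of nu, this component is 0 and its reflection
    is the identity, so that the formula has no exception. *)
Lemma half_turn_reflections nu sigma : sphere nu ->
  half_turn nu sigma = reflection nu *m reflection (orth_part nu sigma).
Proof.
move=> su; apply: half_turn_unique; first exact: half_turnP.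
have eu := dot_orth_part sigma su.
have xe x : dot x nu = 0 -> dot x sigma = 0 -> dot x (orth_part nu sigma) = 0.
  by move=> xu xs; rewrite dotBr dotZr xu xs mulr0 subrr.
have [k se] : exists k, sigma = orth_part nu sigma + k *: nu.
  by exists (dot sigma nu); rewrite subrK.
move: (orth_part _ _) => e in eu xe se *.
have nuN : nu *m (reflection nu *m reflection e) = - nu.
  by rewrite mulmxA mul_reflection_self mulNmx reflection_fix// dotC.
have sN : sigma *m (reflection nu *m reflection e) = - sigma.
  rewrite se mulmxDl -scalemxAl nuN mulmxA (reflection_fix eu) mul_reflection_self.
  by rewrite scalerN opprD.
split=> [x /sub_addsmxP[[u v] /= ->]|x xu xs].
  by rewrite mulmxDl -(mulmxA u) -(mulmxA v) nuN sN !mulmxN -opprD.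
by rewrite mulmxA !reflection_fix// xe.
Qed.

Lemma half_turn_orthogonal nu sigma : sphere nu ->
  orthogonal_mx (half_turn nu sigma).
Proof.
move=> su; rewrite half_turn_reflections//.
by apply: orthogonal_mxM; exact: reflection_orthogonal.
Qed.

Lemma mul_half_turn nu sigma : sphere nu -> nu *m half_turn nu sigma = - nu.
Proof. by move=> su; have [+ _] := half_turnP nu sigma; apply; exact: addsmxSl. Qed.

Lemma half_turn_trace nu sigma : sphere nu -> orth_part nu sigma != 0 ->
  \tr (half_turn nu sigma) = d%:R - 4.
Proof.
move=> su e0; rewrite half_turn_reflections//.
rewrite trace_mul_reflections ?(sphere_dot su) ?oner_eq0//; last first.
  by apply: contra_neq e0; exact: dotxx_eq0.
by rewrite dotC dot_orth_part// expr0n /= mulr0 mul0r addr0.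
Qed.

End euclidean_complements.

(** * Measurability in R^d, and integrals of functions bounded on a carrier *)

Section measurability.
Context {R : realType} {d : nat}.
Local Notation E := 'rV[R]_d.

Lemma measurable_coord (i : 'I_d) :
  measurable_fun setT (fun x : E => x 0 i : measurableTypeR R).
Proof.
move=> _ Y mY; rewrite setTI; apply: sub_sigma_algebra => /=.
rewrite -bigcup_seq/=; exists i => /=; first by rewrite mem_index_enum.
by exists Y => //; rewrite setTI.
Qed.

Context {dT : measure_display} {T : measurableType dT}.

Lemma measurable_rV (f : T -> E) :
  (forall i, measurable_fun setT (fun t => f t 0 i : measurableTypeR R)) ->
  measurable_fun setT f.
Proof.
move=> mf _ A mA; rewrite setTI.
pose G : set (set E) := image_set_system setT f measurable.
suff : G A by rewrite /G /image_set_system /= setTI.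
move: A mA; apply: smallest_sub.
  by apply: sigma_algebra_image; exact: sigma_algebra_measurable.
rewrite -bigcup_seq/= => A [i _ [B mB <-]].
rewrite /G /image_set_system /= setTI.
by have := mf i measurableT B mB; rewrite !setTI.
Qed.

Lemma measurable_comp_coord (f : T -> E) i : measurable_fun setT f ->
  measurable_fun setT (fun t => f t 0 i : R).
Proof. by move=> mf; exact: (measurableT_comp (measurable_coord i)). Qed.

Lemma measurable_dot (f g : T -> E) :
  measurable_fun setT f -> measurable_fun setT g ->
  measurable_fun setT (fun t => dot (f t) (g t)).
Proof.
move=> mf mg; apply: measurable_sum => i.
by apply: measurable_funM; exact: measurable_comp_coord.
Qed.

Lemma measurable_mulmx (f : T -> E) (Q : 'M[R]_d) :
  measurable_fun setT f -> measurable_fun setT (fun t => f t *m Q).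
Proof.
move=> mf; apply: measurable_rV => i; under eq_fun do rewrite mxE.
apply: measurable_sum => j.
by apply: measurable_funM => //; exact: measurable_comp_coord.
Qed.

Lemma measurable_addv (f g : T -> E) :
  measurable_fun setT f -> measurable_fun setT g ->
  measurable_fun setT (fun t => f t + g t).
Proof.
move=> mf mg; apply: measurable_rV => i; under eq_fun do rewrite mxE.
by apply: measurable_funD; exact: measurable_comp_coord.
Qed.

Lemma measurable_scalev (a : T -> R) (f : T -> E) :
  measurable_fun setT a -> measurable_fun setT f ->
  measurable_fun setT (fun t => a t *: f t).
Proof.
move=> ma mf; apply: measurable_rV => i; under eq_fun do rewrite mxE.
by apply: measurable_funM => //; exact: measurable_comp_coord.
Qed.

Lemma measurable_subv (f g : T -> E) :
  measurable_fun setT f -> measurable_fun setT g ->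
  measurable_fun setT (fun t => f t - g t).
Proof.
move=> mf mg; apply: measurable_rV => i; under eq_fun do rewrite !mxE.
by apply: measurable_funB; exact: measurable_comp_coord.
Qed.

Lemma measurable_reflection (f w : T -> E) :
  measurable_fun setT f -> measurable_fun setT w ->
  measurable_fun setT (fun t => f t *m reflection (w t)).
Proof.
(* The inverse of dot w w >= 0 is written as a power with exponent -1, whose
   measurability is known. *)
move=> mf mw; under [X in measurable_fun _ X]eq_fun do
  rewrite mul_reflection -(powR_inv1 (dotxx_ge0 _)).
apply: measurable_subv => //; apply: measurable_scalev => //.
apply: measurable_funM; first by apply: measurable_funM => //; exact: measurable_dot.
apply: (@measurableT_comp _ _ _ _ _ _ (fun a : R => a `^ (-1))) => //.
exact: measurable_dot.
Qed.

Lemma measurable_half_turn (f s : T -> E) nu : sphere nu ->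
  measurable_fun setT f -> measurable_fun setT s ->
  measurable_fun setT (fun t => f t *m half_turn nu (s t)).
Proof.
move=> su mf ms; under [X in measurable_fun _ X]eq_fun do
  rewrite half_turn_reflections// mulmxA.
apply: measurable_reflection; first exact: measurable_mulmx.
apply: measurable_subv => //; apply: measurable_scalev => //.
exact: measurable_dot.
Qed.

End measurability.

Section measurable_sets.
Context {R : realType} {d : nat}.
Local Notation E := 'rV[R]_d.

Lemma measurable_dot_level (f g : E -> E) (k : R) :
  measurable_fun setT f -> measurable_fun setT g ->
  measurable [set x | dot (f x) (g x) = k].
Proof.
move=> mf mg; rewrite -[X in measurable X]setTI.
exact: (measurable_dot mf mg measurableT (measurable_set1 k)).
Qed.

Lemma measurable_sphere : measurable (sphere : set E).
Proof.
have -> : (sphere : set E) = [set x | dot x x = 1].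
  apply/seteqP; split=> x; [exact: sphere_dot | exact: sphereE].
exact: (@measurable_dot_level id id).
Qed.

Lemma measurable_latitude theta n : measurable (latitude theta n : set E).
Proof.
apply: measurableI; first exact: measurable_sphere.
exact: (@measurable_dot_level (cst n) id).
Qed.

End measurable_sets.

Section carried.
Context {R : realType} {dT : measure_display} {T : measurableType dT}.
Context (P : probability T R) (A : set T).
Hypotheses (mA : measurable A) (PA : P A = 1%E).

Lemma carried_setC : P (~` A) = 0%E.
Proof. by rewrite probability_setC// PA subee. Qed.

Lemma carried_ae (p : T -> Prop) :
  (forall t, A t -> p t) -> {ae P, forall t, p t}.
Proof.
move=> Ap; exists (~` A); split; [exact: measurableC|exact: carried_setC|].
by move=> t /= npt At; apply: npt; exact: Ap.
Qed.

(** Gives the integrability of the averaged functions: a bound is required only on a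
    set carrying P, since the integrands are not bounded on the whole space. *)
Lemma carried_integrable (f : T -> R) (B : R) : measurable_fun setT f ->
  (forall t, A t -> `|f t| <= B) -> P.-integrable setT (EFin \o f).
Proof.
move=> mf fB.
apply/(negligible_integrable (measurableC mA)) => //.
- exact/measurable_EFinP.
- exact: carried_setC.
rewrite setTD setCK; apply: measurable_bounded_integrable => //.
- by rewrite [X in (X < _)%E](_ : _ = P A) ?PA ?ltry.
- exact: measurable_funS mf.
- exists B; split; [exact: num_real|] => M BM t At /=.
  by rewrite (le_trans (fB t At))// ltW.
Qed.

Lemma carried_integral (f g : T -> R) :
  measurable_fun setT f -> measurable_fun setT g ->
  (forall t, A t -> f t = g t) ->
  (\int[P]_t (f t)%:E = \int[P]_t (g t)%:E)%E.
Proof.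
move=> mf mg fg; apply: ae_eq_integral => //; try exact/measurable_EFinP.
by apply: carried_ae => t At _; rewrite fg.
Qed.

Lemma carried_integral_cst (f : T -> R) (k : R) : measurable_fun setT f ->
  (forall t, A t -> f t = k) -> (\int[P]_t (f t)%:E = k%:E)%E.
Proof.
move=> mf fk; rewrite (@carried_integral f (cst k))//.
rewrite [LHS](integral_cst P measurableT k%:E) -[RHS]mule1; congr (_ * _)%E.
exact: probability_setT.
Qed.

End carried.

Lemma carried_prod {R : realType} d1 d2 (T1 : measurableType d1)
    (T2 : measurableType d2) (P1 : probability T1 R) (P2 : probability T2 R)
    (A : set T1) : measurable A -> P1 A = 1%E ->
  (P1 \x P2)%E (A `*` [set: T2]) = 1%E.
Proof.
move=> mA PA; rewrite product_measure1E// -[RHS]mule1.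
by congr (_ * _)%E; [exact: PA|exact: probability_setT].
Qed.

(** * Second moments of a law on the sphere *)

Section second_moment.
Context {R : realType} {d : nat}.
Local Notation E := 'rV[R]_d.
Implicit Types (P : probability E R) (Q A : 'M[R]_d).

Lemma measurable_quad A : measurable_fun setT (fun x : E => dot x (x *m A)).
Proof. by apply: measurable_dot => //; exact: measurable_mulmx. Qed.

Lemma coord_unit_le1 (x : E) i : sphere x -> `|x 0 i| <= 1.
Proof.
move=> /sphere_dot; rewrite /dot (bigD1 i)//= => x1.
rewrite -(@ler_sqr _ `|_|) ?nnegrE// real_normK ?num_real// expr1n -x1 expr2.
by rewrite lerDl sumr_ge0// => j _; rewrite -expr2 sqr_ge0.
Qed.

Lemma integral_invariant P Q (f : E -> R) :
  (forall B, measurable B -> P ((fun x => x *m Q) @^-1` B) = P B) ->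
  measurable_fun setT f ->
  P.-integrable setT (EFin \o (fun x => f (x *m Q))) ->
  (\int[P]_x (f (x *m Q))%:E = \int[P]_x (f x)%:E)%E.
Proof.
move=> PQ mf intfQ.
have mQ : measurable_fun setT (fun x : E => x *m Q) by exact: measurable_mulmx.
rewrite -[LHS](@integral_pushforward _ _ _ _ _ _ mQ P setT (EFin \o f))//.
  by apply: (eq_measure_integral P) => B mB _; exact: PQ.
exact/measurable_EFinP.
Qed.

Definition second_moment P : 'M[R]_d :=
  \matrix_(i, j) fine (\int[P]_x (x 0 j * x 0 i)%:E)%E.

Lemma integral_quad P (S : set E) A : measurable S -> P S = 1%E ->
  S `<=` sphere ->
  (\int[P]_x (dot x (x *m A))%:E = (\tr (second_moment P *m A))%:E)%E.
Proof.
move=> mS PS Ssph.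
have intij i j : P.-integrable setT (fun x : E => (x 0 j * x 0 i)%:E).
  apply: (@carried_integrable _ _ _ P S mS PS (fun x : E => x 0 j * x 0 i) 1).
    by apply: measurable_funM; exact: measurable_comp_coord.
  move=> x /Ssph sx; rewrite normrM -[1]mulr1.
  by apply: ler_pM => //; exact: coord_unit_le1.
transitivity (\int[P]_x \sum_(i < d) \sum_(j < d) ((A j i)%:E * (x 0 j * x 0 i)%:E))%E.
  apply: eq_integral => x _; rewrite /dot -sumEFin; apply: eq_bigr => i _.
  rewrite mxE mulr_sumr -sumEFin; apply: eq_bigr => j _.
  by rewrite -EFinM; congr EFin; ring.
rewrite integral_sum//; last first.
  by move=> i; apply: integrable_sum => // j _; exact: integrableZl.
rewrite /mxtrace -sumEFin; apply: eq_bigr => i _.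
rewrite integral_sum//; last by move=> j; exact: integrableZl.
rewrite mxE -sumEFin; apply: eq_bigr => j _.
rewrite integralZl// !mxE EFinM muleC fineK//.
exact: integrable_fin_num.
Qed.

Lemma integrable_quad P (S : set E) A :
  measurable S -> P S = 1%E -> S `<=` sphere ->
  P.-integrable setT (fun x : E => (dot x (x *m A))%:E).
Proof.
move=> mS PS Ssph.
apply: (@carried_integrable _ _ _ P S mS PS (fun x => dot x (x *m A))
  (\sum_i \sum_j `|A j i|)).
  exact: measurable_quad.
move=> x /Ssph sx; apply: (le_trans (ler_norm_sum _ _ _)).
apply: ler_sum => i _; rewrite normrM mxE.
apply: (@le_trans _ _ `|\sum_j x 0 j * A j i|).
  by rewrite ler_piMl// coord_unit_le1.
apply: (le_trans (ler_norm_sum _ _ _)).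
by apply: ler_sum => j _; rewrite normrM ler_piMl// coord_unit_le1.
Qed.

(** The invariance of P gives tr (M Q A Q^T) = tr (M A) for all A, where M is
    the second moment; rank-one matrices A then separate Q^T M Q from M. *)
Lemma second_moment_invariant P (S : set E) Q :
  measurable S -> P S = 1%E -> S `<=` sphere -> orthogonal_mx Q ->
  (forall B, measurable B -> P ((fun x => x *m Q) @^-1` B) = P B) ->
  Q *m second_moment P = second_moment P *m Q.
Proof.
move=> mS PS Ssph oQ PQ.
have trE A : \tr (second_moment P *m (Q *m A *m Q^T)) = \tr (second_moment P *m A).
  apply: EFin_inj; rewrite -!(integral_quad _ mS PS Ssph).
  have pull (x : E) : dot (x *m Q) (x *m Q *m A) = dot x (x *m (Q *m A *m Q^T)).
    by rewrite dot_mulmx !mulmxA.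
  rewrite -[RHS](integral_invariant PQ (measurable_quad A))//.
  - by apply: eq_integral => x _; rewrite pull.
  - rewrite (_ : _ \o _ = fun x : E => (dot x (x *m (Q *m A *m Q^T)))%:E).
      exact: integrable_quad mS PS Ssph.
    by apply/funext => x /=; rewrite pull.
suff QMQ : Q^T *m second_moment P *m Q = second_moment P.
  by rewrite -{1}QMQ !mulmxA oQ mul1mx.
apply: mx_ext => v; apply/eqP; rewrite -subr_eq0 -mulmxBr; apply/eqP/dotxx_eq0.
move: {2}(v *m _) => u.
rewrite -mxtrace_outer mulmxA mxtrace_mulC mulmxBl raddfB /=.
rewrite -(trE (u^T *m v)) !mulmxA (mxtrace_mulC _ Q^T) !mulmxA subrr//.
Qed.

End second_moment.

(** * The uniform laws on latitudes and on the sphere *)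

Section uniform_laws.
Context {R : realType} {d : nat}.
Local Notation E := 'rV[R]_d.
Implicit Types (P tau : probability E R) (Q A : 'M[R]_d) (nu x y : E).

Lemma orthogonal_latitude theta nu Q : orthogonal_mx Q -> nu *m Q = nu ->
  [set x *m Q | x in latitude theta nu] = latitude theta nu.
Proof.
move=> oQ nuQ; have QTQ := orthogonal_mxT oQ.
apply/seteqP; split=> [_ [x [sx xnu] <-]|x [sx xnu]].
  split; first exact: orthogonal_sphere.
  by rewrite -{1}nuQ dot_orthogonal.
exists (x *m Q^T); last by rewrite -mulmxA QTQ mulmx1.
have oQT : orthogonal_mx Q^T by rewrite /orthogonal_mx trmxK.
split; first exact: orthogonal_sphere.
by rewrite dotC dot_mulmx trmxK nuQ dotC.
Qed.

Lemma orthogonal_sphere_image Q : orthogonal_mx Q ->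
  [set x *m Q | x in (sphere : set E)] = (sphere : set E).
Proof.
move=> oQ; apply/seteqP; split=> [_ [x sx <-]|x sx].
  exact: orthogonal_sphere.
exists (x *m Q^T); last by rewrite -mulmxA orthogonal_mxT// mulmx1.
by apply: orthogonal_sphere => //; rewrite /orthogonal_mx trmxK orthogonal_mxT.
Qed.

(** The two coefficients of the second moment are identified by testing on
    A = 1 and on A = nu^T nu, for which x . (x A) is constant on the latitude. *)
Lemma isotropic_average P theta nu A : (1 < d)%N -> sphere nu ->
  is_uniform (latitude theta nu) P ->
  (\int[P]_x (dot x (x *m A))%:E =
   (cos theta ^+ 2 * dot nu (nu *m A)
    + sin theta ^+ 2 / (d%:R - 1) * (\tr A - dot nu (nu *m A)))%:E)%E.
Proof.
move=> d1 su [PL invP]; have nu1 := sphere_dot su.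
have mL := @measurable_latitude R d theta nu.
have Lsph : latitude theta nu `<=` (sphere : set E) by move=> x [].
have comm w : dot w nu = 0 ->
    reflection w *m second_moment P = second_moment P *m reflection w.
  move=> wu; have oQ := @reflection_orthogonal R d w.
  apply: (second_moment_invariant mL PL Lsph oQ) => B mB; apply: invP => //.
  by apply: orthogonal_latitude => //; rewrite reflection_fix// dotC.
have [alpha [beta ME]] := commutant_reflections d1 su comm.
have quadE B : (\int[P]_x (dot x (x *m B))%:E =
    (beta * \tr B + (alpha - beta) * dot nu (nu *m B))%:E)%E.
  rewrite (integral_quad _ mL PL Lsph) ME; congr EFin.
  rewrite mulmxDl -!scalemxAl mul1mx -mulmxA raddfD /= !linearZ /=.
  by rewrite mxtrace_outer (dotC _ nu).
have total : beta * d%:R + (alpha - beta) = 1.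
  apply: EFin_inj; have := quadE 1%:M.
  rewrite mxtrace1 mulmx1 nu1 mulr1 => <-.
  apply: (carried_integral_cst mL PL); first exact: measurable_quad.
  by move=> x [/sphere_dot x1 _]; rewrite mulmx1.
have axial : alpha = cos theta ^+ 2.
  apply: EFin_inj; have := quadE (nu^T *m nu).
  rewrite mxtrace_outer mulmxA mulmx_dot mul_scalar_mx dotZr nu1 !mulr1.
  rewrite addrCA subrr addr0 => <-.
  apply: (carried_integral_cst mL PL); first exact: measurable_quad.
  move=> x [_ xnu].
  by rewrite mulmxA mulmx_dot mul_scalar_mx dotZr (dotC x) xnu expr2.
have d0 : d%:R - 1 != 0 :> R.
  by rewrite subr_eq0 (eqr_nat R d 1) gtn_eqF.
have betaE : beta = sin theta ^+ 2 / (d%:R - 1).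
  apply: (mulIf d0); rewrite divfK// sin2cos2 -axial mulrBr mulr1; lra.
by rewrite quadE betaE -axial; congr EFin; ring.
Qed.

Lemma measurable_point x : measurable [set x].
Proof.
have -> : [set x] = [set y | dot (y - x) (y - x) = 0].
  apply/seteqP; split=> [y ->|y /dotxx_eq0/eqP]; first by rewrite /= subrr dot0l.
  by rewrite subr_eq0 => /eqP.
have m : measurable_fun setT (fun y : E => y - x) by exact: measurable_subv.
exact: measurable_dot_level.
Qed.

Lemma uniform_sphere_homogeneous tau x y : is_uniform sphere tau ->
  sphere x -> sphere y -> tau [set x] = tau [set y].
Proof.
move=> [_ invtau] /sphere_dot x1 /sphere_dot y1.
have oQ := @reflection_orthogonal R d (x - y).
have xQ : x *m reflection (x - y) = y by apply: reflection_swap; rewrite x1.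
move: (reflection _) (reflectionK (x - y)) => Q QK in oQ xQ *.
rewrite -(invtau _ oQ (orthogonal_sphere_image oQ) _ (measurable_point y)).
congr (tau _); apply/seteqP; split=> [z ->//|z /= zQ].
by rewrite -[z]mulmx1 -[x]mulmx1 -QK !mulmxA xQ zQ.
Qed.

Lemma infinite_sphere : (1 < d)%N ->
  exists x_ : nat -> E, injective x_ /\ forall k, sphere (x_ k).
Proof.
move=> d1.
pose e : E := delta_mx 0 (Ordinal (ltnW d1)).
have se : sphere e.
  apply: sphereE; rewrite /dot (bigD1 (Ordinal (ltnW d1)))//= big1 ?addr0.
    by rewrite mxE !eqxx mulr1.
  by move=> i i0; rewrite mxE (negbTE i0) andbF mul0r.
have e1 := sphere_dot se.
have [f [/sphere_dot f1 fe]] := exists_unit_orthogonal d1 se.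
pose q (k : nat) : R := 1 + k%:R ^+ 2.
have q0 k : q k != 0 by rewrite gt_eqF// ltr_pwDl// sqr_ge0.
(* Rational points of the unit circle of the plane of e and f. *)
exists (fun k => ((1 - k%:R ^+ 2) / q k) *: e + (2 * k%:R / q k) *: f).
split=> [k j|k].
  move=> /(congr1 (dot^~ e)); rewrite !dotDl !dotZl fe e1 !mulr0 !addr0 !mulr1.
  move=> /eqP; rewrite eqr_div// => /eqP; rewrite /q => h.
  have : k%:R ^+ 2 = j%:R ^+ 2 :> R by lra.
  move=> /eqP; rewrite eqrXn2// ?ler0n// eqr_nat => /eqP//.
apply: sphereE; rewrite !dotDl !dotDr !dotZl !dotZr (dotC e f) fe e1 f1.
by have := q0 k; rewrite /q => qk; field.
Qed.

(** All points of the sphere have the same mass, and there are infinitely many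
    of them for a total mass 1. *)
Lemma uniform_sphere_atomless tau nu : (1 < d)%N -> is_uniform sphere tau ->
  sphere nu -> tau [set nu] = 0%E.
Proof.
move=> d1 utau su; have [x_ [x_inj sx]] := infinite_sphere d1.
have fp : tau [set nu] \is a fin_num.
  by rewrite fin_num_measure//; exact: measurable_point.
set p := fine (tau [set nu]).
have pE : tau [set nu] = p%:E by rewrite fineK.
have p0 : 0 <= p by rewrite -lee_fin -pE measure_ge0.
have bound n : p *+ n <= 1.
  have mU : measurable (\big[setU/set0]_(k < n) [set x_ k]).
    by apply: bigsetU_measurable => k _; exact: measurable_point.
  have := probability_le1 tau mU.
  have -> : tau (\big[setU/set0]_(k < n) [set x_ k]) =
      (\sum_(k < n) tau [set x_ k])%E.
    apply: (@measure_bigsetU _ _ _ tau (fun k => [set x_ k])) => //.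
      by move=> k; exact: measurable_point.
    apply/trivIsetP => i j _ _ ij; apply/seteqP; split=> // z [/= -> /x_inj/eqP].
    by rewrite (negbTE ij).
  under eq_bigr do rewrite (uniform_sphere_homogeneous utau (sx _) su) pE.
  by rewrite sumEFin sumr_const card_ord lee_fin.
rewrite pE; congr EFin; apply/eqP; rewrite eq_le p0 andbT leNgt; apply/negP => pgt0.
have := bound (Num.truncn p^-1).+1; rewrite leNgt => /negP; apply.
rewrite -mulr_natr -ltr_pdivrMl// mulr1; exact: truncnS_gt.
Qed.

(** The axis of nu meets the sphere only at nu and - nu, both of mass 0. *)
Lemma uniform_sphere_axis_null tau nu : (1 < d)%N -> is_uniform sphere tau ->
  sphere nu -> {ae tau, forall s, orth_part nu s != 0}.
Proof.
move=> d1 utau su.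
have snu : sphere (- nu) by apply: sphereE; rewrite dotNl dotNr opprK (sphere_dot su).
have mS := @measurable_sphere R d.
exists ((~` sphere) `|` ([set nu] `|` [set - nu])); split.
- by apply: measurableU; [exact: measurableC|apply: measurableU; exact: measurable_point].
- have m1 := measurable_point nu; have m2 := measurable_point (- nu).
  have mC : measurable (~` (sphere : set E)) by exact: measurableC.
  have p1 := uniform_sphere_atomless d1 utau su.
  have p2 := uniform_sphere_atomless d1 utau snu.
  have p12 : tau ([set nu] `|` [set - nu]) = 0%E by rewrite measureU0.
  rewrite measureU0//; first exact: (carried_setC mS utau.1).
  exact: measurableU.
move=> s /= /negP; rewrite negbK subr_eq0 => /eqP sE.
have [ss|] := pselect (sphere s); [right|by left].
have := sphere_dot ss; rewrite sE dotZl dotZr (sphere_dot su) mulr1 => /eqP.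
rewrite -expr2 sqrf_eq1 => /orP[] /eqP k1; [left|right].
  by rewrite /= k1 scale1r.
by rewrite /= k1 scaleN1r.
Qed.

End uniform_laws.

(** * The cost increment of a collision *)

Section coupled_transition_average.
Context {R : realType} {d : nat}.
Local Notation E := 'rV[R]_d.
Implicit Types (P tau : probability E R) (nu nv u v us vs : E).

Definition cost u v us vs : R := enorm (u - v) ^+ 2 + enorm (us - vs) ^+ 2.

(** The pre-collisional state is itself the outcome of the collision with
    directions nu and nv, and the cost of an outcome depends on its directions m
    and n only through - r s m . n, by the parallelogram identity. *)
Lemma cost_increment u v us vs nu nv x y :
  enorm (u - us) *: nu = u - us -> enorm (v - vs) *: nv = v - vs ->
  sphere nu -> sphere nv -> sphere x -> sphere y ->
  cost (collide u us x) (collide v vs y)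
       (collide_star u us x) (collide_star v vs y) - cost u v us vs
  = enorm (u - us) * enorm (v - vs) * (dot nu nv - dot x y).
Proof.
move=> eu ev /sphere_dot nu1 /sphere_dot nv1 /sphere_dot x1 /sphere_dot y1.
pose r := enorm (u - us); pose s := enorm (v - vs).
(* The difference of the two centres of mass. *)
pose a := 2^-1 *: (u + us) - 2^-1 *: (v + vs).
have half (z zs : E) : z = 2^-1 *: (z + zs) + 2^-1 *: (z - zs).
  apply/rowP => i; rewrite !mxE /=; by field.
have halfs (z zs : E) : zs = 2^-1 *: (z + zs) - 2^-1 *: (z - zs).
  apply/rowP => i; rewrite !mxE /=; by field.
have key m n : sphere m -> sphere n ->
    cost (collide u us m) (collide v vs n) (collide_star u us m) (collide_star v vs n)
    = 2 * dot a a + 2^-1 * (r * r + s * s) - r * s * dot m n.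
  move=> /sphere_dot m1 /sphere_dot n1; rewrite /cost !enorm_sqr.
  rewrite /collide /collide_star -/r -/s.
  have -> : 2^-1 *: (u + us) + (2^-1 * r) *: m - (2^-1 *: (v + vs) + (2^-1 * s) *: n)
      = a + ((2^-1 * r) *: m - (2^-1 * s) *: n).
    by rewrite /a; apply/rowP => i; rewrite !mxE; ring.
  have -> : 2^-1 *: (u + us) - (2^-1 * r) *: m - (2^-1 *: (v + vs) - (2^-1 * s) *: n)
      = a - ((2^-1 * r) *: m - (2^-1 * s) *: n).
    by rewrite /a; apply/rowP => i; rewrite !mxE; ring.
  clearbody a.
  rewrite !(dotBl, dotBr, dotDl, dotDr, dotZl, dotZr) m1 n1 (dotC n m).
  by rewrite (dotC m a) (dotC n a); field.
have before : cost u v us vs = cost (collide u us nu) (collide v vs nv)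
    (collide_star u us nu) (collide_star v vs nv).
  rewrite /collide /collide_star -!scalerA eu ev.
  by rewrite -!half -!halfs.
rewrite before !key//; [by rewrite -/r -/s; ring| exact: sphereE..].
Qed.

Lemma measurable_collide dT (T : measurableType dT) u us (f : T -> E) :
  measurable_fun setT f -> measurable_fun setT (fun t => collide u us (f t)).
Proof. by move=> mf; apply: measurable_addv => //; exact: measurable_scalev. Qed.

Lemma measurable_collide_star dT (T : measurableType dT) u us (f : T -> E) :
  measurable_fun setT f -> measurable_fun setT (fun t => collide_star u us (f t)).
Proof. by move=> mf; apply: measurable_subv => //; exact: measurable_scalev. Qed.

Lemma measurable_cost dT (T : measurableType dT) (f g fs gs : T -> E) :
  measurable_fun setT f -> measurable_fun setT g ->
  measurable_fun setT fs -> measurable_fun setT gs ->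
  measurable_fun setT (fun t => cost (f t) (g t) (fs t) (gs t)).
Proof.
move=> mf mg mfs mgs; rewrite /cost; under eq_fun do rewrite !enorm_sqr.
by apply: measurable_funD; apply: measurable_dot; exact: measurable_subv.
Qed.

(** Both forms of the coupled transition are image laws of a probability space by
    a map (f, g), so that this reduces each of them to the mean of f . g. *)
Lemma average_cost_increment dT (T : measurableType dT) (P : probability T R)
    (A : set T) (f g : T -> E) u v us vs nu nv (kappa : R) :
  enorm (u - us) *: nu = u - us -> enorm (v - vs) *: nv = v - vs ->
  sphere nu -> sphere nv ->
  measurable A -> P A = 1%E ->
  measurable_fun setT f -> measurable_fun setT g ->
  (forall t, A t -> sphere (f t) /\ sphere (g t)) ->
  (\int[P]_t (dot (f t) (g t))%:E = kappa%:E)%E ->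
  (\int[pushforward P (fun t => (f t, g t))]_p
     (cost (collide u us p.1) (collide v vs p.2)
           (collide_star u us p.1) (collide_star v vs p.2) - cost u v us vs)%:E
   = (enorm (u - us) * enorm (v - vs) * (dot nu nv - kappa))%:E)%E.
Proof.
move=> eu ev su sv mA PA mf mg Afg fgk.
pose h (p : E * E) := cost (collide u us p.1) (collide v vs p.2)
  (collide_star u us p.1) (collide_star v vs p.2) - cost u v us vs.
pose rs := enorm (u - us) * enorm (v - vs).
have mh : measurable_fun setT h.
  apply: measurable_funB => //; apply: measurable_cost.
  - exact: measurable_collide.
  - exact: measurable_collide.
  - exact: measurable_collide_star.
  - exact: measurable_collide_star.
have mfg : measurable_fun setT (fun t => (f t, g t)) by exact: measurable_fun_pair.
have mhfg : measurable_fun setT (fun t => h (f t, g t)).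
  exact: (measurableT_comp mh mfg).
have mdot : measurable_fun setT (fun t => dot (f t) (g t)) by exact: measurable_dot.
have idot : P.-integrable setT (fun t => (dot (f t) (g t))%:E).
  by apply: (carried_integrable (B := 1) mA PA mdot) => t /Afg[]; exact: dot_unit_le1.
have hE t : A t -> h (f t, g t) = rs * (dot nu nv - dot (f t) (g t)).
  by move=> /Afg[sf sg]; exact: cost_increment.
have mR : measurable_fun setT (fun t => rs * (dot nu nv - dot (f t) (g t))).
  by apply: measurable_funM => //; exact: measurable_funB.
rewrite [LHS](_ : _ = \int[pushforward P (fun t => (f t, g t))]_p (EFin \o h) p)%E//.
rewrite (integral_pushforward mfg)//.
- rewrite preimage_setT (carried_integral mA PA mhfg mR hE).
  under eq_integral do rewrite EFinM EFinB.
  have icst : P.-integrable setT (cst (dot nu nv)%:E).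
    by apply: finite_measure_integrable_cst.
  rewrite integralZl//; last exact: integrableB.
  rewrite integralB_EFin// fgk.
  by rewrite (carried_integral_cst mA PA (f := cst (dot nu nv)) (k := dot nu nv)).
- exact/measurable_EFinP.
- apply: (carried_integrable (f := fun t => h (f t, g t))
    (B := `|rs| * (1 + 1)) mA PA) => //.
  move=> t At; rewrite hE// normrM ler_wpM2l//.
  have [sf sg] := Afg t At.
  rewrite (le_trans (ler_normB _ _))// lerD// dot_unit_le1//.
Qed.

End coupled_transition_average.

(** * Wallis integrals *)

Section wallis.
Context {R : realType}.
Local Notation mu := (@lebesgue_measure R).

Lemma integrable_sinX (a b : R) k :
  mu.-integrable `[a, b] (EFin \o (fun x => sin x ^+ k)).
Proof.
apply: continuous_compact_integrable; first exact: segment_compact.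
apply: continuous_subspaceT => x.
have dsin : derivable (@sin R ^+ k) x 1 by [].
rewrite (_ : (fun _ => _) = @sin R ^+ k); last by apply/funext => y; rewrite fctE.
exact/differentiable_continuous/derivable1_diffP.
Qed.

(** The function - sin^(k+1) cos vanishes at 0 and pi/2, and its derivative is
    (k+2) sin^(k+2) - (k+1) sin^k. *)
Lemma sin_integral_recursion k :
  k.+2%:R * sin_integral k.+2 = k.+1%:R * sin_integral k :> R.
Proof.
pose F : R -> R := - (sin ^+ k.+1 * cos).
pose f x : R := k.+2%:R * sin x ^+ k.+2 - k.+1%:R * sin x ^+ k.
have dF (x : R) : is_derive x 1 F (f x).
  apply: is_derive_eq.
  rewrite /f /GRing.scale /= !fctE !exprS.
  transitivity (sin x ^+ 2 * sin x ^+ k - k.+1%:R * sin x ^+ k * cos x ^+ 2).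
    by ring.
  by rewrite cos2sin2; ring.
have cF (x : R) : F y @[y --> x] --> F x.
  exact/differentiable_continuous/derivable1_diffP.
have pi0 : (0 : R) < pi / 2 by rewrite divr_gt0// pi_gt0.
have FTC : (\int[mu]_(x in `[0%R, (pi / 2)%R]) (f x)%:E = 0)%E.
  rewrite (@continuous_FTC2 _ f F)//.
  - by rewrite /F !fctE sin0 cos_pihalf expr0n /= mulr0 mul0r subee.
  - apply: continuous_subspaceT => x.
    have fE : f = (k.+2%:R : R) *: (@sin R ^+ k.+2) - (k.+1%:R : R) *: (@sin R ^+ k).
      by apply/funext => y; rewrite /f !fctE.
    have df : derivable f x 1 by rewrite fE.
    exact/differentiable_continuous/derivable1_diffP.
  - split; [by move=> x _|exact: cvg_at_right_filter|exact: cvg_at_left_filter].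
  - by move=> x _; rewrite derive1E derive_val.
have := FTC; rewrite /f; under eq_integral do
  rewrite EFinB (EFinM k.+2%:R) (EFinM k.+1%:R).
have i1 := integrable_sinX 0 (pi / 2) k.+2.
have i0 := integrable_sinX 0 (pi / 2) k.
rewrite integralB//; [|exact: integrableZl..].
rewrite !integralZl//.
have fin j : (\int[mu]_(x in `[0%R, (pi / 2)%R]) (sin x ^+ j)%:E
    = (sin_integral j)%:E)%E.
  rewrite /sin_integral /Rintegral fineK//.
  exact/integrable_fin_num/integrable_sinX.
by rewrite !fin -!EFinM -EFinB => -[/eqP]; rewrite subr_eq0 => /eqP.
Qed.

Lemma sin_integral_neq0 k : sin_integral k != 0 :> R.
Proof.
suff : sin_integral k != 0 :> R /\ sin_integral k.+1 != 0 :> R by case.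
have pi0 : (0 : R) < pi / 2 by rewrite divr_gt0// pi_gt0.
elim: k => [|k [k0 k1]]; split=> //.
- rewrite /sin_integral; under eq_Rintegral do rewrite expr0.
  rewrite Rintegral_cst// mul1r.
  have := @lebesgue_measure_itv R `[0, pi / 2]; rewrite /= lte_fin pi0 sube0 => h.
  rewrite [X in fine X]h /= gt_eqF//.
- have dF (x : R) : is_derive x 1 (- @cos R) (sin x).
    by apply: is_derive_eq; rewrite opprK.
  have cF (x : R) : (- @cos R) y @[y --> x] --> (- @cos R) x.
    exact/differentiable_continuous/derivable1_diffP.
  rewrite /sin_integral /Rintegral (@continuous_FTC2 _ _ (- @cos R))//.
  + by rewrite !fctE cos0 cos_pihalf -EFinB /= oppr0 sub0r opprK oner_neq0.
  + by apply: continuous_subspaceT; exact: continuous_sin.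
  + split; [by move=> x _|exact: cvg_at_right_filter|exact: cvg_at_left_filter].
  + by move=> x _; rewrite derive1E derive_val expr1.
- apply/eqP => k20; have := sin_integral_recursion k; rewrite k20 mulr0 => /esym/eqP.
  by rewrite mulf_eq0 (negbTE k0) pnatr_eq0.
Qed.

End wallis.

(** * The coupled transition *)

Section coupled_average.
Context {R : realType} {d : nat}.
Local Notation E := 'rV[R]_d.
Implicit Types (P tau : probability E R) (nu nv u v us vs : E).

(** The common value of the mean of n'_u . n'_v under both forms of the coupled
    transition. *)
Definition coupled_mean (theta : R) nu nv : R :=
  cos theta ^+ 2 * dot nu nv
  + sin theta ^+ 2 / (d%:R - 1) * (d%:R - 2 + dot nu nv).

Lemma coupling_average P theta nu nv : (1 < d)%N -> sphere nu -> sphere nv ->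
  nu <> - nv -> is_uniform (latitude theta nu) P ->
  (\int[P]_x (dot x (x *m coupling nu nv))%:E = (coupled_mean theta nu nv)%:E)%E.
Proof.
move=> d1 su sv nuv uP; rewrite (isotropic_average _ d1 su uP).
have [_ _ ->] := couplingP su sv nuv.
by rewrite coupling_trace//; congr EFin; rewrite /coupled_mean; ring.
Qed.

(** For each sigma off the axis of nu the integral in n'_u is already the
    announced value. *)
Lemma half_turn_average P tau theta nu : (1 < d)%N -> sphere nu ->
  is_uniform (latitude theta nu) P -> is_uniform sphere tau ->
  (\int[P \x tau]_p (dot p.1 (p.1 *m half_turn nu p.2))%:E
   = (coupled_mean theta nu (- nu))%:E)%E.
Proof.
move=> d1 su uP utau; have mL := @measurable_latitude R d theta nu.
pose f (p : E * E) := dot p.1 (p.1 *m half_turn nu p.2).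
have mf : measurable_fun setT f.
  apply: measurable_dot; first exact: measurable_fst.
  by apply: measurable_half_turn; [|exact: measurable_fst|exact: measurable_snd].
have mLT : measurable (latitude theta nu `*` [set: E]) by exact: measurableX.
have PLT : (P \x tau)%E (latitude theta nu `*` [set: E]) = 1%E.
  exact: carried_prod mL uP.1.
have intf : (P \x tau)%E.-integrable setT (EFin \o f).
  apply: (carried_integrable (B := 1) mLT PLT mf) => -[x s] [[/= sx _] _].
  apply: dot_unit_le1 => //; apply: orthogonal_sphere => //.
  exact: half_turn_orthogonal.
rewrite -[LHS](integral21_prod_meas1 intf) /fubini_G /=.
rewrite (ae_eq_integral (cst (coupled_mean theta nu (- nu))%:E))//.
- rewrite integral_cst// -[RHS]mule1; congr (_ * _)%E; exact: probability_setT.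
- exact: measurable_fubini_G intf.
have [N [mN N0 sN]] := uniform_sphere_axis_null d1 utau su.
exists N; split => // s /= ns; apply: sN => /= s0; apply: ns => _.
rewrite /f /= (isotropic_average _ d1 su uP) half_turn_trace//.
rewrite mul_half_turn//; congr EFin; rewrite /coupled_mean dotNr (sphere_dot su).
ring.
Qed.

Lemma coupled_cost_average (c : R -> E -> probability E R) tau theta
    (eu ev : E) u v us vs :
  let nu := direction eu (u - us) in let nv := direction ev (v - vs) in
  (1 < d)%N -> sphere eu -> sphere ev ->
  is_uniform (latitude theta nu) (c theta nu) -> is_uniform sphere tau ->
  (\int[coupled_transition c tau theta nu nv]_p
     (cost (collide u us p.1) (collide v vs p.2)
           (collide_star u us p.1) (collide_star v vs p.2) - cost u v us vs)%:E
   = (enorm (u - us) * enorm (v - vs) *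
      (dot nu nv - coupled_mean theta nu nv))%:E)%E.
Proof.
move=> nu nv d1 seu sev uP utau.
have su : sphere nu := direction_sphere (u - us) seu.
have sv : sphere nv := direction_sphere (v - vs) sev.
have mL := @measurable_latitude R d theta nu.
rewrite /coupled_transition; case: eqVneq => [nuv|/eqP nuv].
- have mLT : measurable (latitude theta nu `*` [set: E]) by exact: measurableX.
  have PLT : (c theta nu \x tau)%E (latitude theta nu `*` [set: E]) = 1%E.
    exact: carried_prod mL uP.1.
  apply: (average_cost_increment (enorm_direction eu _) (enorm_direction ev _)
    su sv mLT PLT).
  + exact: measurable_fst.
  + by apply: measurable_half_turn; [|exact: measurable_fst|exact: measurable_snd].
  + move=> [x s] [[/= sx _] _]; split=> //.
    by apply: orthogonal_sphere => //; exact: half_turn_orthogonal.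
  + have -> : nv = - nu by rewrite nuv opprK.
    exact: half_turn_average.
- apply: (average_cost_increment (enorm_direction eu _) (enorm_direction ev _)
    su sv mL uP.1).
  + exact: measurable_id.
  + exact: measurable_mulmx.
  + move=> x [sx _]; split=> //.
    by apply: orthogonal_sphere => //; exact: coupling_orthogonal.
  + exact: coupling_average.
Qed.

End coupled_average.

Theorem proposition4p9 (R : realType) (d : nat)
    (b : {measure set (measurableTypeR R) -> \bar R})
    (c : R -> 'rV[R]_d -> probability 'rV[R]_d R)
    (tau : probability 'rV[R]_d R) (eu ev : 'rV[R]_d) :
  (3 <= d)%N ->
  (lambda b < +oo)%E ->
  (forall theta n, 0 <= theta <= pi -> sphere n ->
    is_uniform (latitude theta n) (c theta n)) ->
  is_uniform sphere tau ->
  sphere eu -> sphere ev ->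
  forall u v us vs : 'rV[R]_d,
    let rhs := (lambda b *
      (sin_integral (d - 1) / sin_integral (d - 3) *
       (enorm (u - us) * enorm (v - vs) - dot (u - us) (v - vs)))%:E)%E in
    coupling_creation b c tau eu ev u v us vs = rhs /\ (0 <= rhs)%E.
Proof.
move=> d3 lfin uc utau seu sev u v us vs rhs.
have d1 : (1 < d)%N by exact: ltnW.
pose nu := direction eu (u - us); pose nv := direction ev (v - vs).
have su : sphere nu := direction_sphere (u - us) seu.
have sv : sphere nv := direction_sphere (v - vs) sev.
pose D := enorm (u - us) * enorm (v - vs) - dot (u - us) (v - vs).
have DE : D = enorm (u - us) * enorm (v - vs) * (1 - dot nu nv).
  rewrite /D -{2}(enorm_direction eu (u - us)) -{2}(enorm_direction ev (v - vs)).
  by rewrite dotZl dotZr -/nu -/nv; ring.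
pose K : R := sin_integral (d - 1) / sin_integral (d - 3).
have KE : K = (d%:R - 2) / (d%:R - 1).
  have [k dE] : exists k, d = k.+3 by exists (d - 3)%N; rewrite -addn3 subnK.
  rewrite /K dE !subSS !subn0.
  have := sin_integral_recursion (R := R) k; have := sin_integral_neq0 (R := R) k.
  move: (sin_integral k) (sin_integral k.+2) => x y x0 h.
  have k2 : k.+2%:R != 0 :> R by rewrite pnatr_eq0.
  have -> : k.+3%:R - 2 = k.+1%:R :> R by ring.
  have -> : k.+3%:R - 1 = k.+2%:R :> R by ring.
  by apply/eqP; rewrite eqr_div// mulrC h.
have D0 : 0 <= D.
  rewrite DE mulr_ge0 ?mulr_ge0 ?sqrtr_ge0// subr_ge0.
  exact: le_trans (ler_norm _) (dot_unit_le1 su sv).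
have K0 : 0 <= K.
  by rewrite KE divr_ge0// subr_ge0 ?(ler_nat R 2)// ?(ler_nat R 1) ltnW.
have l0 : (0 <= lambda b)%E by apply: integral_ge0 => t _; rewrite lee_fin sqr_ge0.
have isin : b.-integrable `[0%R, pi] (EFin \o (fun t : R => sin t ^+ 2)).
  apply/integrableP; split.
    apply/measurable_EFinP; apply: measurable_funTS.
    apply: measurable_funX.
    by apply: continuous_measurable_fun; exact: continuous_sin.
  apply: le_lt_trans lfin; rewrite le_eqVlt; apply/orP; left; apply/eqP.
  by apply: eq_integral => t _; rewrite /= ger0_norm ?sqr_ge0.
split; last by rewrite mule_ge0// lee_fin mulr_ge0.
rewrite /coupling_creation /coupled_generator -/nu -/nv.
have inner t : 0 <= t <= pi ->
    (\int[coupled_transition c tau t nu nv]_p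
      (cost (collide u us p.1) (collide v vs p.2)
         (collide_star u us p.1) (collide_star v vs p.2) - cost u v us vs)%:E
    = (- (K * D))%:E * (sin t ^+ 2)%:E)%E.
  move=> t0pi.
  rewrite coupled_cost_average//; last exact: uc.
  rewrite -EFinM; congr EFin; rewrite KE DE /coupled_mean cos2sin2 -/nu -/nv.
  have : d%:R - 1 != 0 :> R by rewrite subr_eq0 (eqr_nat R d 1) gtn_eqF.
  by move=> d0; field.
transitivity (- (\int[b]_(t in `[0%R, pi])
    ((- (K * D))%:E * (sin t ^+ 2)%:E)))%E.
  congr (- _)%E; apply: eq_integral => t.
  by rewrite inE/= in_itv/=; exact: inner.
by rewrite integralZl// EFinN mulNe oppeK muleC.
Qed.
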